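(* Let $n\ge 2$ and let $\mu_0,\mu_1,\dots,\mu_n$ be the sequence of distributions obtained by applying a sequence of $n$ moves to an initial distribution $\mu_0$ with $\mu_0\{x\le 0\}\le n$ and $\mu_0\{x>0\}=0$. Then $\mu_n\{x>2n^{1/3}\log_2 n\}<1$.
   Context: A (discrete mass) distribution is a finite set $\mu=\{(x_1,m_1),\dots,(x_k,m_k)\}$ with $x_i\in\mathbb R$ and $m_i>0$; a signed distribution is the same without the positivity requirement. For $A\subseteq\mathbb R$, $\mu(A)=\sum_{x_i\in A}m_i$, and $\mu\{x>a\}$ means $\mu(\{x:x>a\})$, etc. Moments: $M_j[\mu]=\sum_i m_ix_i^j$. A move $v=([a,b],\delta)$ consists of an interval with $b-a=1$ and a signed distribution $\delta$ supported in $[a,b]$ with $M_0[\delta]=M_1[\delta]=0$; its center is $\frac{a+b}2$. It can be applied to $\mu$ if $\mu+\delta$ is a distribution, and then $v\mu=\mu+\delta$. A sequence of moves $v_1,\dots,v_\ell$ applied to $\mu_0$ produces $\mu_i=v_i\mu_{i-1}$. *)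

(* Defs.v *)
From Stdlib Require Import Reals Lra List.
Import ListNotations.
Open Scope R_scope.

(* A signed distribution is a finite list of (point, mass) pairs; it denotes
   the signed measure sum_i m_i * delta_{x_i}.  Repeated points are allowed
   (their masses add), so addition of (signed) distributions is concatenation. *)
Definition sdist := list (R * R).

Definition mass_at (mu : sdist) (y : R) : R :=
  fold_right (fun p acc => (if Req_EM_T (fst p) y then snd p else 0) + acc) 0 mu.

Definition mass_le (mu : sdist) (a : R) : R :=
  fold_right (fun p acc => (if Rle_dec (fst p) a then snd p else 0) + acc) 0 mu.

Definition mass_gt (mu : sdist) (a : R) : R :=
  fold_right (fun p acc => (if Rlt_dec a (fst p) then snd p else 0) + acc) 0 mu.

Definition moment (j : nat) (mu : sdist) : R :=
  fold_right (fun p acc => snd p * (fst p) ^ j + acc) 0 mu.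

(* A (nonnegative) distribution: every point carries nonnegative total mass
   (points of zero mass are simply absent from the measure). *)
Definition is_dist (mu : sdist) : Prop := forall y, 0 <= mass_at mu y.

Record move := Move { mv_a : R; mv_delta : sdist }.

Definition valid_move (v : move) : Prop :=
  Forall (fun p => mv_a v <= fst p <= mv_a v + 1) (mv_delta v) /\
  moment 0 (mv_delta v) = 0 /\ moment 1 (mv_delta v) = 0.

Definition apply_move (v : move) (mu : sdist) : sdist := mu ++ mv_delta v.

Definition applicable (v : move) (mu : sdist) : Prop :=
  is_dist (apply_move v mu).

Definition move_sequence (n : nat) (vs : nat -> move) (mus : nat -> sdist) : Prop :=
  is_dist (mus 0%nat) /\
  forall i, (i < n)%nat ->
    valid_move (vs i) /\ applicable (vs i) (mus i) /\
    mus (S i) = apply_move (vs i) (mus i).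

Definition log2 (x : R) : R := ln x / ln 2.

(* Main.v *)
Require Import Defs.
From Stdlib Require Import Reals List.
From Stdlib Require Import ZArith Lra Lia.
Import ListNotations.
Open Scope R_scope.

(** Write [f_i t] for the integral of [(x - t)^+] against [mu_i].  It is convex in [t], and a move
    changes it only inside the unit interval of the move.  With [d = n^(1/3)], if
    [f_i r <= c] for all [i] then [f_i (r + d) <= c / 2] for all [i]: on [[r, +oo)] the [f_i] stay
    below the potentials of a process [nu_i] that starts from the mass [c / d] at [r + d] and moves all
    mass of each interval (cut at [r]) to its endpoints.  If one such step raises half the second moment
    of [nu] about [r] by [A], it lowers the energy, the double integral of [min x y - r], by at least
    [4 A^2].  The energy starts at [c^2 / d] and stays nonnegative, which bounds half the second
    moment by [c d], hence [f_i (r + d)] by [c / 2].  Since [f_i 0 <= n^2 / 4], about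
    [2 log2 n] halvings reduce the potential, and with it the mass further out, below [1]. *)

(** * Integration against finite signed measures *)

Definition integral (mu : sdist) (phi : R -> R) : R :=
  fold_right (fun p acc => snd p * phi (fst p) + acc) 0 mu.

Lemma integral_app mu nu phi :
  integral (mu ++ nu) phi = integral mu phi + integral nu phi.
Proof. induction mu as [|p mu IH]; simpl; [|rewrite IH]; lra. Qed.

Lemma integral_ext_in mu phi psi :
  (forall p, In p mu -> phi (fst p) = psi (fst p)) ->
  integral mu phi = integral mu psi.
Proof.
  induction mu as [|p mu IH]; simpl; intros H; [reflexivity|].
  rewrite (H p) by auto. rewrite IH by auto. reflexivity.
Qed.

Lemma integral_ext mu phi psi :
  (forall x, phi x = psi x) -> integral mu phi = integral mu psi.
Proof. intros H; apply integral_ext_in; auto. Qed.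

Lemma integral_lin mu a b phi psi :
  integral mu (fun x => a * phi x + b * psi x)
  = a * integral mu phi + b * integral mu psi.
Proof. induction mu as [|p mu IH]; simpl; [|rewrite IH]; lra. Qed.

Lemma integral_scal mu a phi :
  integral mu (fun x => a * phi x) = a * integral mu phi.
Proof. induction mu as [|p mu IH]; simpl; [|rewrite IH]; lra. Qed.

Lemma integral_minus mu phi psi :
  integral mu (fun x => phi x - psi x) = integral mu phi - integral mu psi.
Proof. induction mu as [|p mu IH]; simpl; [|rewrite IH]; lra. Qed.

Lemma integral_split mu y phi :
  integral mu phi = mass_at mu y * phi y
    + integral (filter (fun p => if Req_EM_T (fst p) y then false else true) mu) phi.
Proof.
  induction mu as [|p mu IH]; simpl; [lra|].
  rewrite IH. destruct (Req_EM_T (fst p) y) as [<-|]; simpl; lra.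
Qed.

Lemma mass_at_filter_neq mu y z :
  mass_at (filter (fun p => if Req_EM_T (fst p) y then false else true) mu) z
  = if Req_EM_T z y then 0 else mass_at mu z.
Proof.
  induction mu as [|p mu IH]; simpl; [destruct Req_EM_T; reflexivity|].
  destruct (Req_EM_T (fst p) y) as [e|e]; simpl; rewrite IH;
    destruct (Req_EM_T z y); destruct (Req_EM_T (fst p) z); subst; try lra;
    exfalso; congruence.
Qed.

(* A single list entry may be negative, so the entries sitting at one point are removed together. *)
Lemma integral_dist_nonneg mu phi :
  is_dist mu -> (forall p, In p mu -> 0 <= phi (fst p)) -> 0 <= integral mu phi.
Proof.
  remember (length mu) as l eqn:Hl.
  assert (Hlen : (length mu <= l)%nat) by lia. clear Hl.
  revert mu Hlen. induction l as [|l IH]; intros mu Hlen Hd Hphi;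
    destruct mu as [|p mu]; try (simpl in *; lra || lia).
  rewrite (integral_split _ (fst p)).
  apply Rplus_le_le_0_compat.
  - apply Rmult_le_pos; [apply Hd | apply Hphi; left; reflexivity].
  - apply IH.
    + simpl. destruct Req_EM_T; [|congruence].
      etransitivity; [apply filter_length_le|]. simpl in Hlen; lia.
    + intros y. rewrite mass_at_filter_neq. destruct Req_EM_T; [lra|apply Hd].
    + intros q Hq. apply filter_In in Hq. apply Hphi, Hq.
Qed.

Lemma integral_dist_le mu phi psi :
  is_dist mu -> (forall p, In p mu -> phi (fst p) <= psi (fst p)) ->
  integral mu phi <= integral mu psi.
Proof.
  intros Hd H.
  assert (0 <= integral mu (fun x => psi x - phi x)).
  { apply integral_dist_nonneg; [assumption|]. intros p Hp; specialize (H p Hp); lra. }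
  rewrite integral_minus in *. lra.
Qed.

(** Used for the dominating process: [spread] keeps every single entry nonnegative, so no regrouping
    by points is needed. *)
Lemma integral_entries_le mu phi psi :
  Forall (fun p => 0 <= snd p /\ phi (fst p) <= psi (fst p)) mu ->
  integral mu phi <= integral mu psi.
Proof.
  induction 1 as [|p mu [H1 H2] _ IH]; simpl; [lra|].
  assert (snd p * phi (fst p) <= snd p * psi (fst p)) by (apply Rmult_le_compat_l; lra).
  lra.
Qed.

(** * Potentials of distributions *)

Definition call (mu : sdist) (t : R) : R := integral mu (fun x => Rmax 0 (x - t)).

(** The chord inequality is cleared of its denominator, so [a = b] needs no exception. *)
Definition convex (f : R -> R) : Prop :=
  forall a b t, a <= t <= b -> (b - a) * f t <= (b - t) * f a + (t - a) * f b.

Lemma Rmax_spec a b : (a <= b /\ Rmax a b = b) \/ (b <= a /\ Rmax a b = a).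
Proof. destruct (Rle_dec a b); [left|right]; split; try lra;
  [apply Rmax_right|apply Rmax_left]; lra. Qed.

Lemma Rmin_spec a b : (a <= b /\ Rmin a b = a) \/ (b <= a /\ Rmin a b = b).
Proof. destruct (Rle_dec a b); [left|right]; split; try lra;
  [apply Rmin_left|apply Rmin_right]; lra. Qed.

Ltac case_minmax :=
  repeat match goal with
  | |- context [Rmax ?a ?b] => destruct (Rmax_spec a b) as [[? ->]|[? ->]]
  | |- context [Rmin ?a ?b] => destruct (Rmin_spec a b) as [[? ->]|[? ->]]
  end.

Lemma call_convex mu : is_dist mu -> convex (call mu).
Proof.
  intros Hd a b t Ht. unfold call.
  rewrite <- integral_scal, <- integral_lin.
  apply integral_dist_le; [assumption|]. intros [x m] _; simpl.
  case_minmax; nra.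
Qed.

Lemma call_nonneg mu t : is_dist mu -> 0 <= call mu t.
Proof.
  intros Hd. apply integral_dist_nonneg; [assumption|].
  intros p _. apply Rmax_l.
Qed.

Lemma moment0_integral mu : moment 0 mu = integral mu (fun _ => 1).
Proof. induction mu as [|p mu IH]; simpl in *; [|rewrite IH]; lra. Qed.

Lemma moment1_integral mu : moment 1 mu = integral mu (fun x => x).
Proof. induction mu as [|p mu IH]; simpl in *; [|rewrite IH]; lra. Qed.

(** For such [t] the function [Rmax 0 (x - t)] is affine in [x] on the support of the move, and the
    two vanishing moments annihilate affine functions. *)
Lemma call_apply_move v mu t :
  valid_move v -> t <= mv_a v \/ mv_a v + 1 <= t ->
  call (apply_move v mu) t = call mu t.
Proof.
  intros (Hs & H0 & H1) Ht. unfold call, apply_move. rewrite integral_app.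
  rewrite Forall_forall in Hs.
  rewrite moment0_integral in H0. rewrite moment1_integral in H1.
  enough (integral (mv_delta v) (fun x => Rmax 0 (x - t)) = 0) by lra.
  destruct Ht as [Ht|Ht].
  - rewrite (integral_ext_in _ _ (fun x => 1 * x + (- t) * 1)).
    + rewrite integral_lin. nra.
    + intros p Hp. specialize (Hs p Hp). simpl in Hs. rewrite Rmax_right; lra.
  - rewrite (integral_ext_in _ _ (fun x => 0 * 1)).
    + rewrite integral_scal. lra.
    + intros p Hp. specialize (Hs p Hp). simpl in Hs. rewrite Rmax_left; lra.
Qed.

Lemma integral_mass_split mu a :
  integral mu (fun _ => 1) = mass_le mu a + mass_gt mu a.
Proof.
  induction mu as [|p mu IH]; simpl; [lra|rewrite IH].
  destruct Rle_dec; destruct Rlt_dec; lra.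
Qed.

Lemma mass_gt_integral mu a :
  mass_gt mu a = integral mu (fun x => if Rlt_dec a x then 1 else 0).
Proof.
  induction mu as [|p mu IH]; simpl; [lra|rewrite IH].
  destruct Rlt_dec; lra.
Qed.

(** Markov's inequality, used at the very end to pass from potential to mass. *)
Lemma mass_gt_le_call mu a b :
  is_dist mu -> a < b -> (b - a) * mass_gt mu b <= call mu a.
Proof.
  intros Hd Hab. rewrite mass_gt_integral, <- integral_scal.
  apply integral_dist_le; [assumption|]. intros [x m] _; simpl.
  destruct Rlt_dec; case_minmax; lra.
Qed.

Lemma exists_support_bound (mu : sdist) : exists M, forall p, In p mu -> fst p <= M.
Proof.
  induction mu as [|p mu [M HM]]; [exists 0; intros ? []|].
  exists (Rmax (fst p) M). intros q [<-|Hq]; [apply Rmax_l|].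
  eapply Rle_trans; [apply HM, Hq|apply Rmax_r].
Qed.

(** Entries beyond [a] may still be listed with cancelling masses. The integrand is therefore
    compared with a multiple of the indicator of [x > a], the factor coming from a bound [M] on the
    support. *)
Lemma call_eq0 mu a t : is_dist mu -> mass_gt mu a = 0 -> a <= t -> call mu t = 0.
Proof.
  intros Hd H0 Ht. apply Rle_antisym; [|apply call_nonneg, Hd].
  destruct (exists_support_bound mu) as [M HM].
  replace 0 with (Rmax 0 (M - t) * mass_gt mu a) by (rewrite H0; ring).
  rewrite mass_gt_integral, <- integral_scal.
  apply integral_dist_le; [assumption|]. intros p Hp. specialize (HM p Hp).
  destruct Rlt_dec; case_minmax; lra.
Qed.

Lemma call_slope_bound mu a b :
  is_dist mu -> a <= b -> call mu a <= call mu b + (b - a) * integral mu (fun _ => 1).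
Proof.
  intros Hd Hab. unfold call.
  rewrite <- (Rmult_1_l (integral mu (fun x => Rmax 0 (x - b)))), <- integral_lin.
  apply integral_dist_le; [assumption|]. intros p _. case_minmax; lra.
Qed.

Lemma call_antitone mu a b : is_dist mu -> a <= b -> call mu b <= call mu a.
Proof.
  intros Hd Hab. apply integral_dist_le; [assumption|]. intros p _. case_minmax; lra.
Qed.

(** * Sweeping the mass of an interval to its endpoints *)

Section Interpolation.
Variables (a b : R).
Hypothesis Hab : a < b.

Definition interp (phi : R -> R) (x : R) : R :=
  if Rle_dec a x then if Rle_dec x b then
    ((b - x) * phi a + (x - a) * phi b) / (b - a) else phi x else phi x.

(** The weights preserve mass and barycentre; [interp] is the dual operation on test functions. *)
Definition spread_point (p : R * R) : sdist :=
  if Rle_dec a (fst p) then if Rle_dec (fst p) b then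
    [(a, snd p * (b - fst p) / (b - a)); (b, snd p * (fst p - a) / (b - a))]
  else [p] else [p].

Definition spread (nu : sdist) : sdist := flat_map spread_point nu.

Lemma integral_spread nu phi : integral (spread nu) phi = integral nu (interp phi).
Proof.
  induction nu as [|[x m] nu IH]; [reflexivity|].
  unfold spread; simpl flat_map. rewrite integral_app. fold (spread nu). rewrite IH.
  unfold spread_point, interp; simpl.
  destruct (Rle_dec a x); [destruct (Rle_dec x b)|]; simpl; field; lra.
Qed.

(** Interpolation is linear in the function. This allows the double integral of the energy to be
    interpolated in both variables. *)
Lemma interp_integral nu (g : R -> R -> R) x :
  interp (fun x => integral nu (g x)) x
  = integral nu (fun y => interp (fun x => g x y) x).
Proof.
  unfold interp. destruct (Rle_dec a x); [destruct (Rle_dec x b)|]; try reflexivity.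
  symmetry. etransitivity.
  - apply (integral_ext _ _ (fun y => ((b - x) / (b - a)) * g a y + ((x - a) / (b - a)) * g b y)).
    intros y. field; lra.
  - rewrite (integral_lin nu _ _ (g a) (g b)). field; lra.
Qed.

Lemma call_spread_out nu t : t <= a \/ b <= t -> call (spread nu) t = call nu t.
Proof.
  intros Ht. unfold call. rewrite integral_spread. apply integral_ext. intros x.
  unfold interp. destruct (Rle_dec a x); [destruct (Rle_dec x b)|]; try reflexivity.
  destruct Ht.
  - rewrite !Rmax_right by lra. field; lra.
  - rewrite !Rmax_left by lra. field; lra.
Qed.

(** For [x] in [[a, b]] both integrands equal [(x - a) * (b - t)]. The new potential is thus the
    chord of the old one, the largest convex function with these endpoint values. *)
Lemma call_spread_in nu t : a <= t <= b ->
  (b - a) * call (spread nu) t = (b - t) * call nu a + (t - a) * call nu b.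
Proof.
  intros Ht. unfold call. rewrite integral_spread, <- integral_scal, <- integral_lin.
  apply integral_ext. intros x.
  unfold interp. destruct (Rle_dec a x); [destruct (Rle_dec x b)|].
  - rewrite (Rmax_left 0 (a - t)), (Rmax_right 0 (b - t)), (Rmax_right 0 (x - a)),
      (Rmax_left 0 (x - b)) by lra. field; lra.
  - rewrite !Rmax_right by lra. ring.
  - rewrite !Rmax_left by lra. ring.
Qed.

Lemma spread_Forall r nu :
  r <= a -> Forall (fun p => r <= fst p /\ 0 <= snd p) nu ->
  Forall (fun p => r <= fst p /\ 0 <= snd p) (spread nu).
Proof.
  intros Hr H. unfold spread. apply Forall_flat_map.
  eapply Forall_impl; [|exact H]. intros [x m] [H1 H2]; unfold spread_point; simpl in *.
  assert (0 < / (b - a)) by (apply Rinv_0_lt_compat; lra).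
  destruct (Rle_dec a x); [destruct (Rle_dec x b)|];
    repeat (apply Forall_cons || apply Forall_nil); simpl; split; try lra;
    apply Rmult_le_pos; nra.
Qed.

(** On [[a, b]], the solution of [u'' = -1] vanishing at both ends: the gain of [x ^ 2 / 2] under
    interpolation. *)
Definition bump (x : R) : R :=
  if Rle_dec a x then if Rle_dec x b then (x - a) * (b - x) / 2 else 0 else 0.

Lemma interp_square r x :
  interp (fun x => (x - r) ^ 2 / 2) x = (x - r) ^ 2 / 2 + bump x.
Proof.
  unfold interp, bump. destruct (Rle_dec a x); [destruct (Rle_dec x b)|]; field; lra.
Qed.

(* For [x <= y] in [[a, b]] the difference of the two sides is the Green function
   [(x - a) (b - y) / (b - a)] of the interval minus the last term. *)
Lemma interp_min r x y : b - a <= 1 ->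
  interp (fun x => interp (fun y => Rmin x y - r) y) x + 4 * bump x * bump y
  <= Rmin x y - r.
Proof.
  intros HL.
  (* Here [4 * bump u * bump v] is written out. The bound follows from
     [(b - u) * (v - a) <= 1 <= / (b - a)], multiplied by [(u - a) * (b - v)]. *)
  assert (G : forall u v, a <= u <= v -> v <= b ->
    a - r + (u - a) * (v - a) / (b - a)
    + (u - a) * (b - u) * ((v - a) * (b - v)) <= u - r).
  { intros u v Hu Hv.
    replace (a - r + (u - a) * (v - a) / (b - a))
      with (u - r - (u - a) * (b - v) * / (b - a)) by (field; lra).
    assert (1 <= / (b - a)) by (rewrite <- Rinv_1; apply Rinv_le_contravar; lra).
    assert (0 <= (u - a) * (b - v)) by nra.
    assert ((b - u) * (v - a) <= 1) by nra.
    nra. }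
  unfold interp, bump.
  destruct (Rle_dec a x); [destruct (Rle_dec x b)|];
  (destruct (Rle_dec a y); [destruct (Rle_dec y b)|]);
  rewrite ?(Rmin_left a a), ?(Rmin_left a b), ?(Rmin_right b a), ?(Rmin_left b b) by lra;
  try lra.
  - match goal with |- ?l + _ <= _ =>
      replace l with (a - r + (x - a) * (y - a) / (b - a)) by (field; lra) end.
    destruct (Rle_dec x y).
    + rewrite Rmin_left by lra. specialize (G x y). lra.
    + rewrite Rmin_right by lra. specialize (G y x). lra.
  (* In the remaining cases one point lies outside [[a, b]]; the minimum is affine in the other one
     there, so interpolation reproduces it. *)
  - rewrite !Rmin_left by lra. right. field; lra.
  - rewrite !Rmin_right by lra. right. field; lra.
  - rewrite !Rmin_right by lra. right. field; lra.
  - rewrite !Rmin_left by lra. right. field; lra.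
Qed.
End Interpolation.

(** * Energy, inertia and the dominating process *)

(** For [nu] on [[r, +oo)] this is the integral over [t >= r] of the squared mass beyond [t]. *)
Definition energy (r : R) (nu : sdist) : R :=
  integral nu (fun x => integral nu (fun y => Rmin x y - r)).

Definition inertia (r : R) (nu : sdist) : R :=
  integral nu (fun x => (x - r) ^ 2 / 2).

Lemma inertia_spread r a b nu : a < b ->
  inertia r (spread a b nu) = inertia r nu + integral nu (bump a b).
Proof.
  intros Hab. unfold inertia. rewrite integral_spread by assumption.
  rewrite (integral_ext _ _ (fun x => 1 * ((x - r) ^ 2 / 2) + 1 * bump a b x)).
  - rewrite integral_lin. ring.
  - intros x. rewrite interp_square by assumption. ring.
Qed.

(** [interp_min] is integrated in both variables; its product term becomes the square of the
    integral of [bump]. *)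
Lemma energy_spread r a b nu :
  a < b -> b - a <= 1 -> Forall (fun p => r <= fst p /\ 0 <= snd p) nu ->
  energy r (spread a b nu) + 4 * integral nu (bump a b) ^ 2 <= energy r nu.
Proof.
  intros Hab HL Hnu. unfold energy.
  rewrite integral_spread by assumption.
  set (A := integral nu (bump a b)).
  assert (Hpos : forall phi psi : R -> R, (forall x, phi x <= psi x) ->
    integral nu phi <= integral nu psi).
  { intros phi psi H. apply integral_entries_le.
    eapply Forall_impl; [|exact Hnu]. intros p [_ Hp]; auto. }
  replace (4 * A ^ 2) with (integral nu (fun x => 4 * A * bump a b x)).
  2:{ rewrite integral_scal. unfold A. ring. }
  rewrite <- (Rmult_1_l (integral nu (interp _ _ _))),
    <- (Rmult_1_l (integral nu (fun x => 4 * A * _))), <- integral_lin.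
  apply Hpos. intros x.
  match goal with |- 1 * interp _ _ ?F _ + _ <= _ =>
    replace (interp a b F x) with
      (integral nu (fun y => interp a b (fun x => interp a b (fun y => Rmin x y - r) y) x))
  end.
  2:{ rewrite <- interp_integral by assumption. unfold interp.
      destruct (Rle_dec a x); [destruct (Rle_dec x b)|];
      rewrite ?integral_spread by assumption; reflexivity. }
  replace (1 * (4 * A * bump a b x)) with (4 * bump a b x * A) by ring.
  unfold A. rewrite <- integral_lin.
  apply Hpos. intros y.
  pose proof (interp_min a b Hab r x y HL). lra.
Qed.

Lemma energy_nonneg r nu :
  Forall (fun p => r <= fst p /\ 0 <= snd p) nu -> 0 <= energy r nu.
Proof.
  intros Hnu.
  replace 0 with (integral nu (fun _ => 0 * 0)) by (rewrite integral_scal; ring).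
  apply integral_entries_le. rewrite Forall_forall in *. intros p Hp.
  split; [apply Hnu, Hp|].
  replace (0 * 0) with (integral nu (fun _ => 0 * 0)) by (rewrite integral_scal; ring).
  apply integral_entries_le, Forall_forall. intros q Hq. split; [apply Hnu, Hq|].
  destruct (Hnu p Hp), (Hnu q Hq). case_minmax; lra.
Qed.

(** With [s = x - r], the line [2 * d * (s - d)] is tangent to [s ^ 2 / 2] at [s = 2 * d]. *)
Lemma call_le_inertia r d nu : 0 < d ->
  Forall (fun p => r <= fst p /\ 0 <= snd p) nu ->
  2 * d * call nu (r + d) <= inertia r nu.
Proof.
  intros Hd Hnu. unfold call, inertia. rewrite <- integral_scal.
  apply integral_entries_le. eapply Forall_impl; [|exact Hnu].
  intros [x m] [H1 H2]; simpl in *. split; [assumption|].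
  pose proof (pow2_ge_0 (x - r - 2 * d)). pose proof (pow2_ge_0 (x - r)).
  case_minmax; nra.
Qed.

(* A process of convex functions, each step of which changes the function only inside a unit
   interval, is dominated on [[r, +oo)] by the process of spreading moves started at the mass
   [c / d] placed at [r + d]; [c] bounds the values at [r], so moves straddling [r] may be cut
   at [r]. *)
Lemma dominating_spread (n : nat) (f : nat -> R -> R) (a : nat -> R) (r c d lam : R) :
  0 < d -> 0 <= c ->
  (forall i, (i <= n)%nat -> convex (f i)) ->
  (forall i t, (i < n)%nat -> t <= a i \/ a i + 1 <= t -> f (S i) t = f i t) ->
  (forall t, r <= t -> f 0%nat t = 0) ->
  (forall i, (i <= n)%nat -> f i r <= c) ->
  forall i, (i <= n)%nat ->
  exists nu, Forall (fun p => r <= fst p /\ 0 <= snd p) nu /\ call nu r = c /\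
    (forall t, r <= t -> f i t <= call nu t) /\
    energy r nu + lam * inertia r nu <= c ^ 2 / d + lam * (c * d / 2) + INR i * (lam ^ 2 / 16).
Proof.
  intros Hd Hc Hconv Hloc H0 Hr. induction i as [|i IH]; intros Hi.
  - assert (0 <= c / d) by (apply Rmult_le_pos; [lra|left; apply Rinv_0_lt_compat; lra]).
    exists [(r + d, c / d)]. split; [|split; [|split]].
    + apply Forall_cons; [simpl; lra|apply Forall_nil].
    + unfold call; simpl. rewrite Rmax_right by lra. field; lra.
    + intros t Ht. rewrite H0 by assumption. unfold call; simpl.
      pose proof (Rmax_l 0 (r + d - t)). nra.
    + right. unfold energy, inertia; simpl. rewrite Rmin_left by lra. field; lra.
  - destruct (IH ltac:(lia)) as (nu & Hnu & Hcr & Hdom & Hphi).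
    assert (Hlam2 : 0 <= lam ^ 2 / 16) by nra.
    rewrite S_INR.
    (* An interval left of [r] does not affect [[r, +oo)], so [nu] is kept. *)
    destruct (Rle_dec (a i + 1) r) as [Hout|Hin].
    + exists nu. repeat split; try assumption; [|lra].
      intros t Ht. rewrite Hloc by (lia || (right; lra)). auto.
    + set (l := Rmax (a i) r). set (u := a i + 1).
      assert (Hl : l < u) by (unfold l, u; case_minmax; lra).
      assert (Hlr : r <= l) by apply Rmax_r.
      assert (Hla : a i <= l) by apply Rmax_l.
      exists (spread l u nu). split; [|split; [|split]].
      * apply spread_Forall; assumption.
      * rewrite call_spread_out; auto.
      * intros t Ht. destruct (Rle_dec t l) as [Htl|Htl]; [|destruct (Rle_dec u t) as [Htu|Htu]].
        -- rewrite call_spread_out by auto. unfold l in *.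
           destruct (Rmax_spec (a i) r) as [[E1 E2]|[E1 E2]]; rewrite E2 in *.
           (* If the interval was cut, only [t = r] is left here, where [c] is the bound. *)
           ++ replace t with r by lra. rewrite Hcr. apply Hr, Hi.
           ++ rewrite Hloc by (lia || (left; lra)). auto.
        -- rewrite call_spread_out by auto. rewrite Hloc by (lia || (right; assumption)). auto.
        -- assert (Ht' : l <= t <= u) by lra.
           apply (Rmult_le_reg_l (u - l)); [lra|].
           rewrite call_spread_in by assumption.
           (* The convex [f (S i)] lies below its chord, and the potential of the spread measure is
              a chord; comparing endpoints suffices. *)
           eapply Rle_trans; [apply (Hconv (S i) Hi l u t Ht')|].
           apply Rplus_le_compat; (apply Rmult_le_compat_l; [lra|]).
           ++ unfold l in *.
              destruct (Rmax_spec (a i) r) as [[E1 E2]|[E1 E2]]; rewrite E2 in *.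
              ** rewrite Hcr. apply Hr, Hi.
              ** rewrite Hloc by (lia || (left; lra)). auto.
           ++ rewrite Hloc by (lia || (right; unfold u; lra)). apply Hdom. lra.
      * pose proof (energy_spread r l u nu Hl ltac:(unfold u; lra) Hnu).
        rewrite inertia_spread by assumption.
        (* With [A] the gain of inertia, completing the square gives
           [lam * A - 4 * A ^ 2 <= lam ^ 2 / 16]. *)
        pose proof (pow2_ge_0 (2 * integral nu (bump l u) - lam / 4)). nra.
Qed.

(** * Halving the potential *)

Lemma halving_step (n : nat) (f : nat -> R -> R) (a : nat -> R) (r c d : R) :
  0 < d -> d ^ 3 = INR n -> 0 <= c ->
  (forall i, (i <= n)%nat -> convex (f i)) ->
  (forall i t, (i < n)%nat -> t <= a i \/ a i + 1 <= t -> f (S i) t = f i t) ->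
  (forall t, r <= t -> f 0%nat t = 0) ->
  (forall i, (i <= n)%nat -> f i r <= c) ->
  forall i, (i <= n)%nat -> f i (r + d) <= c / 2.
Proof.
  intros Hd Hn Hc Hconv Hloc H0 Hr i Hi.
  (* The bound [c] may be [0], which would make [lam] vanish; it is enlarged by [e] first. *)
  assert (Hlim : forall e, 0 < e -> f i (r + d) <= (c + e) / 2).
  { intros e He. set (c' := c + e). set (lam := 4 * c' / d ^ 2).
    assert (Hd2 : 0 < d ^ 2) by nra.
    assert (Hlam : 0 < lam) by (apply Rdiv_lt_0_compat; unfold c'; lra).
    destruct (dominating_spread n f a r c' d lam) with (i := i)
      as (nu & Hnu & _ & Hdom & Hphi); auto; try (unfold c'; lra).
    { intros j Hj. specialize (Hr j Hj). unfold c'; lra. }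
    pose proof (energy_nonneg r nu Hnu).
    pose proof (call_le_inertia r d nu Hd Hnu).
    specialize (Hdom (r + d) ltac:(lra)).
    assert (HiN : INR i <= d ^ 3) by (rewrite Hn; apply le_INR, Hi).
    (* For [lam = 4 * c' / d ^ 2] the three terms are [1], [2] and [1] times [c' ^ 2 / d], and
       [lam * (c' * d)] is [4] times it. *)
    assert (HI : lam * inertia r nu <= lam * (c' * d)).
    { assert (INR i * (lam ^ 2 / 16) <= d ^ 3 * (lam ^ 2 / 16))
        by (apply Rmult_le_compat_r; [nra|assumption]).
      assert (c' ^ 2 / d + lam * (c' * d / 2) + d ^ 3 * (lam ^ 2 / 16) = lam * (c' * d))
        by (unfold lam; field; lra).
      lra. }
    apply Rmult_le_reg_l in HI; [|assumption].
    apply (Rmult_le_reg_l (2 * d)); nra. }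
  destruct (Rle_dec (f i (r + d)) (c / 2)) as [|Hno]; [assumption|].
  specialize (Hlim (f i (r + d) - c / 2) ltac:(lra)). lra.
Qed.

(** * Application to move sequences *)

Lemma move_sequence_dist n vs mus :
  move_sequence n vs mus -> forall i, (i <= n)%nat -> is_dist (mus i).
Proof.
  intros [H0 Hs] [|i] Hi; [assumption|].
  destruct (Hs i ltac:(lia)) as (_ & Ha & ->). exact Ha.
Qed.

Lemma move_sequence_mass n vs mus :
  move_sequence n vs mus -> forall i, (i <= n)%nat ->
  integral (mus i) (fun _ => 1) = integral (mus 0%nat) (fun _ => 1).
Proof.
  intros [H0 Hs]. induction i as [|i IH]; intros Hi; [reflexivity|].
  destruct (Hs i ltac:(lia)) as ((_ & Hm & _) & _ & ->).
  unfold apply_move. rewrite integral_app, <- (moment0_integral (mv_delta _)), Hm, IH by lia.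
  ring.
Qed.

(** Only an interval with [a < 0 < a + 1] changes the potential at [0]. The chord bound then allows
    a rise of at most [(a + 1) * (- a) * M], which is at most [M / 4]. *)
Lemma call_at_0_growth n vs mus (M : R) :
  move_sequence n vs mus ->
  integral (mus 0%nat) (fun _ => 1) <= M -> call (mus 0%nat) 0 = 0 ->
  forall i, (i <= n)%nat -> call (mus i) 0 <= INR i * (M / 4).
Proof.
  intros Hms HM H0. induction i as [|i IH]; intros Hi.
  - rewrite H0. simpl; lra.
  - specialize (IH ltac:(lia)). rewrite S_INR.
    pose proof (move_sequence_dist _ _ _ Hms i ltac:(lia)) as Hd.
    pose proof (move_sequence_dist _ _ _ Hms (S i) Hi) as HdS.
    pose proof (move_sequence_mass _ _ _ Hms i ltac:(lia)) as Hmass.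
    destruct Hms as [Hd0 Hs]. destruct (Hs i ltac:(lia)) as (Hv & _ & E).
    assert (0 <= integral (mus 0%nat) (fun _ => 1))
      by (apply integral_dist_nonneg; [assumption|intros; lra]).
    set (a := mv_a (vs i)) in *.
    destruct (Rle_dec 0 a) as [Ha|Ha]; [|destruct (Rle_dec (a + 1) 0) as [Hb|Hb]].
    + rewrite E, call_apply_move by auto. lra.
    + rewrite E, call_apply_move by auto. lra.
    + pose proof (call_convex _ HdS a (a + 1) 0 ltac:(lra)) as Hc.
      (* Only the two endpoint values revert to [mus i]; the value at [0] is the one to be
         bounded. *)
      rewrite E in Hc at 2 3.
      rewrite !call_apply_move in Hc by (auto; unfold a; (left + right); lra).
      pose proof (call_slope_bound _ a 0 Hd ltac:(lra)) as Hs1.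
      pose proof (call_antitone _ 0 (a + 1) Hd ltac:(lra)) as Hs2.
      rewrite Hmass in Hs1.
      set (m := integral (mus 0%nat) (fun _ => 1)) in *.
      assert (call (mus i) a <= call (mus i) 0 + (- a) * M) by nra.
      assert ((a + 1) * call (mus i) a <= (a + 1) * (call (mus i) 0 + (- a) * M)) by nra.
      assert ((- a) * call (mus i) (a + 1) <= (- a) * call (mus i) 0) by nra.
      assert ((a + 1) * (- a) * M <= / 4 * M).
      { apply Rmult_le_compat_r; [lra|]. pose proof (pow2_ge_0 (2 * a + 1)). nra. }
      nra.
Qed.

Lemma call_halving n vs mus (d : R) :
  move_sequence n vs mus -> 0 < d -> d ^ 3 = INR n ->
  mass_le (mus 0%nat) 0 <= INR n -> mass_gt (mus 0%nat) 0 = 0 ->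
  forall j i, (i <= n)%nat ->
  call (mus i) (INR j * d) <= INR n ^ 2 / 4 * (/ 2) ^ j.
Proof.
  intros Hms Hd Hd3 Hle Hgt.
  pose proof (move_sequence_dist _ _ _ Hms) as Hdist.
  assert (H0 : forall t, 0 <= t -> call (mus 0%nat) t = 0).
  { intros t Ht. apply (call_eq0 _ 0); auto. apply Hdist; lia. }
  induction j as [|j IH]; intros i Hi.
  - replace (INR 0 * d) with 0 by (simpl; ring).
    eapply Rle_trans; [apply (call_at_0_growth n vs mus (INR n)); auto|].
    + rewrite (integral_mass_split _ 0). lra.
    + apply H0; lra.
    + apply le_INR in Hi. pose proof (pos_INR n). simpl. nra.
  - rewrite S_INR. replace ((INR j + 1) * d) with (INR j * d + d) by ring.
    replace (INR n ^ 2 / 4 * (/ 2) ^ S j) with (INR n ^ 2 / 4 * (/ 2) ^ j / 2) by (simpl; field).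
    apply (halving_step n (fun i => call (mus i)) (fun i => mv_a (vs i))); auto.
    + apply Rmult_le_pos; [pose proof (pos_INR n); nra|apply pow_le; lra].
    + intros k Hk. apply call_convex, Hdist, Hk.
    + intros k t Hk Ht. destruct Hms as [_ Hs]. destruct (Hs k Hk) as (Hv & _ & ->).
      apply call_apply_move; assumption.
    + intros t Ht. apply H0. pose proof (pos_INR j). nra.
Qed.

Theorem mainTheorem4 (n : nat) (vs : nat -> move) (mus : nat -> sdist) :
  (2 <= n)%nat ->
  move_sequence n vs mus ->
  mass_le (mus 0%nat) 0 <= INR n ->
  mass_gt (mus 0%nat) 0 = 0 ->
  mass_gt (mus n) (2 * Rpower (INR n) (1 / 3) * log2 (INR n)) < 1.
Proof.
  intros Hn Hms Hle Hgt.
  set (d := Rpower (INR n) (1 / 3)).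
  set (th := 2 * log2 (INR n)).
  assert (Hn2 : 2 <= INR n) by (change 2 with (INR 2); apply le_INR, Hn).
  assert (Hd3 : d ^ 3 = INR n).
  { rewrite <- Rpower_pow by apply exp_pos. unfold d. rewrite Rpower_mult.
    replace (1 / 3 * INR 3) with 1 by (simpl; field). apply Rpower_1; lra. }
  assert (Hd1 : 1 <= d).
  { apply Rle_trans with (Rpower (INR n) 0); [rewrite Rpower_O; lra|].
    apply Rle_Rpower; lra. }
  assert (Hln2 : 0 < ln 2) by (rewrite <- ln_1; apply ln_increasing; lra).
  assert (Hth2 : Rpower 2 th = INR n ^ 2).
  { rewrite <- Rpower_pow by lra. unfold Rpower, th, log2. f_equal. simpl. field. lra. }
  assert (Hth : 2 <= th).
  { assert (ln 2 <= ln (INR n)) 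
      by (destruct (Req_dec 2 (INR n)) as [<-|]; [lra|left; apply ln_increasing; lra]).
    assert (1 <= log2 (INR n)).
    { unfold log2. apply (Rmult_le_reg_r (ln 2)); [assumption|].
      unfold Rdiv; rewrite Rmult_assoc, Rinv_l; lra. }
    unfold th; lra. }
  (* After [J] halvings a gap of at least [d >= 1] must remain before [th * d] for Markov's
     inequality, while [J + 2] must exceed [th]. *)
  assert (HJ : exists J : nat, INR J + 1 <= th < INR J + 2).
  { destruct (archimed th) as [H1 H2].
    assert (Hz : (2 < up th)%Z) by (apply lt_IZR; lra).
    exists (Z.to_nat (up th - 2)). rewrite INR_IZR_INZ, Z2Nat.id by lia.
    rewrite minus_IZR. lra. }
  destruct HJ as [J HJ].
  pose proof (call_halving n vs mus d Hms ltac:(lra) Hd3 Hle Hgt J n ltac:(lia)) as Hcall.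
  assert (Hgap : 1 <= (th - INR J) * d).
  { rewrite <- (Rmult_1_l 1). apply Rmult_le_compat; lra. }
  pose proof (mass_gt_le_call (mus n) (INR J * d) (th * d)
    (move_sequence_dist _ _ _ Hms n ltac:(lia)) ltac:(lra)) as Hmass.
  (* The factor [1 / 4] makes up for the two missing halvings: [2 ^ (J + 2)] exceeds [Rpower 2 th],
     which is [INR n ^ 2]. *)
  assert (Hpow : INR n ^ 2 / 4 * (/ 2) ^ J < 1).
  { assert (H : Rpower 2 th < Rpower 2 (INR (J + 2))).
    { apply Rpower_lt; [lra|]. rewrite plus_INR. simpl. lra. }
    rewrite Hth2, Rpower_pow, pow_add in H by lra.
    rewrite pow_inv. assert (0 < 2 ^ J) by (apply pow_lt; lra).
    apply (Rmult_lt_reg_r (2 ^ J)); [assumption|].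
    rewrite Rmult_assoc, Rinv_l; lra. }
  replace (2 * d * log2 (INR n)) with (th * d) by (unfold th; ring).
  destruct (Rlt_dec (mass_gt (mus n) (th * d)) 1) as [|Hno]; [assumption|].
  nra.
Qed.
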